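(* The Rudin–Shapiro sequence $\mathbf{r}$ is $4$-pseudoperiodic, but not $3$-pseudoperiodic.
   Context: The Rudin–Shapiro sequence $\mathbf{r}=00010010\cdots$ is defined for $n\ge0$ by $\mathbf{r}[n]=(\text{number of occurrences of the block }11\text{ in the base-2 representation of }n)\bmod 2$. For integers $k\ge1$ and $0<p_1<\cdots<p_k$, an infinite word $\mathbf{s}$ has pseudoperiod $(p_1,\ldots,p_k)$ if $\mathbf{s}[i]\in\{\mathbf{s}[i+p_1],\ldots,\mathbf{s}[i+p_k]\}$ for all $i\ge0$; it is $k$-pseudoperiodic if it has some pseudoperiod with exactly $k$ entries. *)

(* Defs.v *)
From mathcomp Require Import all_boot.
From Corelib Require Import BinNums.

Set Implicit Arguments.
Unset Strict Implicit.
Unset Printing Implicit Defensive.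

(* Most significant digit first, no leading zeros; true stands for the digit 1. *)
Fixpoint pos_bits (p : positive) : bitseq :=
  match p with
  | xH => [:: true]
  | xO p' => rcons (pos_bits p') false
  | xI p' => rcons (pos_bits p') true
  end.

(* The base-2 representation of 0 is the empty word. *)
Definition base2 (n : nat) : bitseq :=
  match bin_of_nat n with
  | N0 => [::]
  | Npos p => pos_bits p
  end.

(* Overlapping occurrences are counted separately. *)
Definition occurrences (T : eqType) (u w : seq T) : nat :=
  count (fun i => prefix u (drop i w)) (iota 0 (size w)).

Definition rudin_shapiro (n : nat) : nat :=
  occurrences [:: true; true] (base2 n) %% 2.

(* path ltn 0 p says 0 < p_1 < ... < p_k. *)
Definition has_pseudoperiod (T : eqType) (s : nat -> T) (p : seq nat) : Prop :=
  [/\ 0 < size p, path ltn 0 p & forall i, s i \in [seq s (i + q) | q <- p]].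

Definition pseudoperiodic (T : eqType) (k : nat) (s : nat -> T) : Prop :=
  exists p : k.-tuple nat, has_pseudoperiod s p.

(* Main.v *)
Require Import Defs.
From mathcomp Require Import all_boot.
From mathcomp Require Import all_order all_algebra zify ring.

Set Implicit Arguments.
Unset Strict Implicit.
Unset Printing Implicit Defensive.

Import Order.TTheory GRing.Theory Num.Theory.

(** The word has pseudoperiod (2, 3, 4, 5): a window starting at 8 a + b is
    determined by b, the parity of a and the values at a and a + 1.

    For the negative part write e for the word with letters 0, 1 replaced by
    1, -1. From e (2 n) = e n and e (2 n + 1) = (-1)^n e n, the sums over
    n < 2^k of e n * e (n + p) and of (-1)^n * e n * e (n + p) satisfy a joint
    recurrence in p, by which they are bounded in k (for p > 0). If (p, q, r) is a
    pseudoperiod and x, y, z are the products of e n with e (n + p), e (n + q),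
    e (n + r), then (1 - x) (1 - y) (1 - z) = 0 for every n; in the expansion
    the sums of x, y, z, x y, x z, y z are bounded, so the sum of the
    nonnegative terms 1 - x y z is bounded too. Hence x y z = 1 for all large n:
    e satisfies a linear recurrence, so it is eventually periodic, which
    contradicts the boundedness of the correlation at its period. *)

Local Open Scope nat_scope.

(** * Digit recurrences for the word *)

Lemma occurrences_cons (T : eqType) (u : seq T) x w :
  occurrences u (x :: w) = prefix u (x :: w) + occurrences u w.
Proof.
rewrite /occurrences /=; congr (_ + _).
by rewrite (iotaDl 1 0) count_map; apply: eq_count.
Qed.

Lemma occurrences11_rcons w b :
  occurrences [:: true; true] (rcons w b) =
  occurrences [:: true; true] w + (b && last false w).
Proof.
elim: w => [|x w IH]; first by case: b.
rewrite rcons_cons !occurrences_cons IH.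
by case: w {IH} => [|y [|z w]]; case: x; case: b => //=; case: y => //=; lia.
Qed.

Lemma base2_double n : 0 < n -> base2 n.*2 = rcons (base2 n) false.
Proof.
rewrite /base2 -{1 2}[n]bin_of_natK; case: (bin_of_nat n) => [//|p] _.
have -> : (nat_of_bin (BinNums.Npos p)).*2 = BinNums.Npos (BinNums.xO p)
  by rewrite /= NatTrec.doubleE.
by rewrite nat_of_binK.
Qed.

Lemma base2_doubleS n : base2 n.*2.+1 = rcons (base2 n) true.
Proof.
rewrite /base2 -{1}[n]bin_of_natK; case: (bin_of_nat n) => [//|p].
have -> : (nat_of_bin (BinNums.Npos p)).*2.+1 = BinNums.Npos (BinNums.xI p)
  by rewrite /= NatTrec.doubleE.
by rewrite nat_of_binK.
Qed.

(** The default [false] covers n = 0, whose representation is empty. *)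
Lemma last_base2 n : last false (base2 n) = odd n.
Proof.
rewrite -(odd_double_half n); move: (odd n) n./2 => [] m; rewrite ?add1n ?add0n.
  by rewrite base2_doubleS last_rcons /= odd_double.
rewrite odd_double; have [->//|m_gt0] := posnP m.
by rewrite base2_double // last_rcons.
Qed.

Definition rs_bit n := odd (occurrences [:: true; true] (base2 n)).

Lemma rudin_shapiroE n : rudin_shapiro n = rs_bit n.
Proof. by rewrite /rudin_shapiro modn2. Qed.

Lemma rs_bit_double n : rs_bit n.*2 = rs_bit n.
Proof.
have [->//|n_gt0] := posnP n.
by rewrite /rs_bit base2_double // occurrences11_rcons addn0.
Qed.

Lemma rs_bit_doubleS n : rs_bit n.*2.+1 = rs_bit n (+) odd n.
Proof.
by rewrite /rs_bit base2_doubleS occurrences11_rcons last_base2 oddD oddb.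
Qed.

(** The digits of 8a + b are those of a followed by three digits for b. Leading zeros add no block
    11, and a block straddles the junction exactly when a is odd and the first of the three digits
    is 1. *)
Lemma rs_bit_octuple a b : b < 8 ->
  rs_bit (a.*2.*2.*2 + b) = rs_bit a (+) rs_bit b (+) (odd a && (3 < b)).
Proof.
have mod2 c : c.*2.*2.*2.+2 = c.*2.*2.+1.*2 by lia.
have mod3 c : c.*2.*2.*2.+3 = c.*2.*2.+1.*2.+1 by lia.
have mod4 c : c.*2.*2.*2 + 4 = c.*2.+1.*2.*2 by lia.
have mod5 c : c.*2.*2.*2 + 5 = c.*2.+1.*2.*2.+1 by lia.
have mod6 c : c.*2.*2.*2 + 6 = c.*2.+1.*2.+1.*2 by lia.
have mod7 c : c.*2.*2.*2 + 7 = c.*2.+1.*2.+1.*2.+1 by lia.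
have r01 : (rs_bit 0 = false) * (rs_bit 1 = false) by [].
have r23 : (rs_bit 2 = false) * (rs_bit 3 = true) by [].
have r45 : (rs_bit 4 = false) * (rs_bit 5 = false) by [].
have r67 : (rs_bit 6 = true) * (rs_bit 7 = false) by [].
case: b => [|[|[|[|[|[|[|[|//]]]]]]]] _;
  rewrite ?addn0 ?addn1 ?addn2 ?addn3 ?(mod2, mod3, mod4, mod5, mod6, mod7);
  rewrite ?(rs_bit_double, rs_bit_doubleS, r01, r23, r45, r67) /= ?odd_double;
  by case: (rs_bit a); case: (odd a).
Qed.

(** * The pseudoperiod (2, 3, 4, 5) *)

Lemma rudin_shapiro_pseudoperiod_2345 :
  has_pseudoperiod rudin_shapiro [:: 2; 3; 4; 5].
Proof.
split=> // i; rewrite /= !inE !rudin_shapiroE !(inj_eq (can_inj oddb)).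
have [a [b [-> b_lt8]]] : exists a b, i = a.*2.*2.*2 + b /\ b < 8.
  by exists (i %/ 8), (i %% 8); lia.
(* As b + 5 < 16, all positions involved lie in the octuples of a and a + 1, which have opposite
   parities. *)
have window c : c < 16 -> rs_bit (a.*2.*2.*2 + c) =
    if c < 8 then rs_bit a (+) rs_bit c (+) (odd a && (3 < c))
    else rs_bit a.+1 (+) rs_bit (c - 8) (+) (~~ odd a && (11 < c)).
  have [lt_c8 _|le8c lt_c16] := ltnP c 8; first exact: rs_bit_octuple.
  have -> : a.*2.*2.*2 + c = a.+1.*2.*2.*2 + (c - 8) by lia.
  rewrite rs_bit_octuple /=; last by lia.
  by rewrite (_ : (3 < c - 8) = (11 < c)) //; lia.
rewrite -!addnA !window; try lia.
move: (rs_bit a) (rs_bit a.+1) (odd a) => x y z.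
by case: b b_lt8 => [|[|[|[|[|[|[|[|//]]]]]]]] _; case: x; case: y; case: z.
Qed.

(** * Bounded sums over dyadic ranges *)

Local Open Scope ring_scope.

(** Lengths 2^k suit the digit recurrences: pairing 2n with 2n + 1 turns length 2^(k+1) into 2^k. *)
Definition dyadic_bounded (f : nat -> int) : Prop :=
  exists C : nat, forall k, `|\sum_(i < (2 ^ k)%N) f i| <= C%:Z.

Lemma dyadic_bounded_ext (f g : nat -> int) :
  f =1 g -> dyadic_bounded f -> dyadic_bounded g.
Proof.
by move=> fg [C fC]; exists C => k; under eq_bigr do rewrite -fg.
Qed.

Lemma dyadic_boundedD (f g : nat -> int) : dyadic_bounded f -> dyadic_bounded g ->
  dyadic_bounded (fun n => f n + g n).
Proof.
move=> [C fC] [D gD]; exists (C + D)%N => k; rewrite big_split /=.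
rewrite PoszD; apply: le_trans (ler_normD _ _) _; exact: lerD (fC k) (gD k).
Qed.

Lemma dyadic_boundedM (a : int) (f : nat -> int) : dyadic_bounded f ->
  dyadic_bounded (fun n => a * f n).
Proof.
move=> [C fC]; exists (`|a| * C)%N => k.
rewrite -mulr_sumr normrM PoszM abszE.
by apply: ler_wpM2l (fC k); apply: normr_ge0.
Qed.

Lemma sum_pow2S (f : nat -> int) k :
  \sum_(i < (2 ^ k.+1)%N) f i = \sum_(i < (2 ^ k)%N) (f i.*2 + f i.*2.+1).
Proof.
rewrite -(big_mkord xpredT f) -(big_mkord xpredT (fun i => f i.*2 + f i.*2.+1)).
rewrite expnS mul2n; elim: (2 ^ k)%N => [|m IH]; first by rewrite !big_geq.
by rewrite doubleS !big_nat_recr //= IH addrA.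
Qed.

Lemma dyadic_bounded_halve (f : nat -> int) :
  dyadic_bounded (fun n => f n.*2 + f n.*2.+1) -> dyadic_bounded f.
Proof.
(* At k = 0 the sum is the lone term [f 0], out of reach of the pairing. *)
move=> [C fC]; exists (maxn `|f 0%N| C) => [[|k]].
  by rewrite big_ord_recl big_ord0 addr0 /=; lia.
by rewrite sum_pow2S; have := fC k; lia.
Qed.

Lemma dyadic_bounded_shift s (f : nat -> int) : (forall n, `|f n| <= 1) ->
  dyadic_bounded f -> dyadic_bounded (fun n => f (n + s)%N).
Proof.
move=> f1 fb; elim: s => [|s [C fC]].
  by apply: dyadic_bounded_ext fb => n; rewrite addn0.
(* Shifting by one more place changes only the two end terms, each of norm at most 1. *)
exists (C + 2)%N => k.
have telescope m : \sum_(i < m) f (i + s.+1)%N + f s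
      = \sum_(i < m) f (i + s)%N + f (m + s)%N.
  elim: m => [|m IH]; first by rewrite !big_ord0.
  by rewrite !big_ord_recr /= addrAC IH addnS addSn.
have bound (x y a b : int) : x + a = y + b -> `|a| <= 1 -> `|b| <= 1 ->
  `|y| <= C%:Z -> `|x| <= (C + 2)%N%:Z by lia.
exact: bound (telescope _) (f1 _) (f1 _) (fC k).
Qed.

Lemma dyadic_bounded_not1 N (f : nat -> int) : (forall n, `|f n| <= 1) ->
  dyadic_bounded f -> ~ (forall n, (N <= n)%N -> f n = 1).
Proof.
(* At k = C the shifted sum equals 2^C, which exceeds C. *)
move=> f1 /(dyadic_bounded_shift N f1) [C fC] fN; have := fC C.
rewrite (eq_bigr (fun=> 1)) => [|i _]; last by rewrite fN // leq_addl.
by rewrite sumr_const card_ord; have := ltn_expl C (isT : 1 < 2)%N; lia.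
Qed.

(* The double negation keeps the lemma free of excluded middle. *)
Lemma dyadic_bounded_eventually0 (f : nat -> int) :
  (forall n, 0 <= f n) -> dyadic_bounded f ->
  ~ ~ exists N, forall n, (N <= n)%N -> f n = 0.
Proof.
move=> f0 [C fC] no_tail.
have sum_ge0 a b : 0 <= \sum_(a <= i < b) f i by apply: sumr_ge0.
have {fC} : forall m, \sum_(0 <= i < m) f i < C.+1%:Z.
  have bound (x y : int) : 0 <= y -> `|x + y| <= C%:Z -> x < C.+1%:Z by lia.
  move=> m; apply: bound (sum_ge0 m (2 ^ m)%N) _.
  by rewrite -big_cat_nat ?big_mkord //; apply/ltnW/ltn_expl.
(* Induction on the bound, for every starting point N: a nonzero integer term is at least 1, so the
   sums beyond it obey a bound smaller by one. *)
move: C.+1 0%N => {}C; elim: C => [|C IH] N fC.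
  by have := fC N; rewrite big_geq.
apply: no_tail; exists N => n leNn; apply/eqP/negPn/negP => fn0.
apply: (IH n.+1) => m; have {fn0} fn1 : 1 <= f n by have := f0 n; lia.
have bound (x y z : int) :
  0 <= x -> 1 <= y -> x + y + z < C.+1%:Z -> z < C%:Z by lia.
apply: bound (sum_ge0 N n) fn1 _; have [lemn|ltnm] := leqP m n.
  by rewrite [X in _ + X]big_geq ?leqW // addr0 -big_nat_recr.
by rewrite -addrA -(big_ltn ltnm) -big_cat_nat // ltnW.
Qed.

(** * Correlations of the signed word *)

Definition rs_sign n : int := (-1) ^+ rs_bit n.

Lemma rs_sign_double n : rs_sign n.*2 = rs_sign n.
Proof. by rewrite /rs_sign rs_bit_double. Qed.

Lemma rs_sign_doubleS n : rs_sign n.*2.+1 = (-1) ^+ odd n * rs_sign n.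
Proof. by rewrite /rs_sign rs_bit_doubleS signr_addb mulrC. Qed.

Definition corr p n := rs_sign n * rs_sign (n + p).

(** At odd shifts the pair sums of [corr] carry a factor (-1)^n; this twisted companion closes the
    recurrence. *)
Definition alt_corr p n := (-1) ^+ odd n * corr p n.

Lemma norm_corr p n : `|corr p n| <= 1.
Proof. by rewrite /corr /rs_sign normrM !normr_sign. Qed.

Lemma corr_double_pair p n :
  corr p.*2 n.*2 + corr p.*2 n.*2.+1 = (1 + (-1) ^+ odd p) * corr p n.
Proof.
rewrite /corr addSn -doubleD !rs_sign_double !rs_sign_doubleS oddD.
by case: (odd n); case: (odd p) => /=; ring.
Qed.

Lemma corr_doubleS_pair p n : corr p.*2.+1 n.*2 + corr p.*2.+1 n.*2.+1 =
  (-1) ^+ odd p * alt_corr p n + alt_corr p.+1 n.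
Proof.
rewrite /alt_corr /corr addSn !addnS -doubleD -doubleS.
rewrite !rs_sign_double !rs_sign_doubleS oddD.
by case: (odd n); case: (odd p) => /=; ring.
Qed.

Lemma alt_corr_double_pair p n :
  alt_corr p.*2 n.*2 + alt_corr p.*2 n.*2.+1 = (1 - (-1) ^+ odd p) * corr p n.
Proof.
rewrite /alt_corr /corr /= addSn odd_double -doubleD.
rewrite !rs_sign_double !rs_sign_doubleS oddD.
by case: (odd n); case: (odd p) => /=; ring.
Qed.

Lemma alt_corr_doubleS_pair p n :
  alt_corr p.*2.+1 n.*2 + alt_corr p.*2.+1 n.*2.+1 =
  (-1) ^+ odd p * alt_corr p n + (-1) * alt_corr p.+1 n.
Proof.
rewrite /alt_corr /corr /= addSn !addnS odd_double -doubleD -doubleS.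
rewrite !rs_sign_double !rs_sign_doubleS oddD.
by case: (odd n); case: (odd p) => /=; ring.
Qed.

Lemma sum_alt_corr0 k : \sum_(i < (2 ^ k.+1)%N) alt_corr 0 i = 0.
Proof.
rewrite sum_pow2S big1 // => i _.
by rewrite -[0%N]/(0.*2)%N alt_corr_double_pair subrr mul0r.
Qed.

(** At shift 1 the recurrence returns to shift 1 itself, so the induction is on k. The sum over the
    single index 0 is 1, hence the exponent [k.+1]. *)
Lemma sum_alt_corr1 k : \sum_(i < (2 ^ k.+1)%N) alt_corr 1 i = 0.
Proof.
elim: k => [|k IH]; first by rewrite expn1 !big_ord_recl big_ord0.
rewrite sum_pow2S.
rewrite (eq_bigr (fun i : 'I__ => alt_corr 0 i + (-1) * alt_corr 1 i)).
  by rewrite big_split -mulr_sumr /= IH sum_alt_corr0.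
by move=> i _; rewrite (alt_corr_doubleS_pair 0) mul1r.
Qed.

Lemma dyadic_bounded_of_sums0 (f : nat -> int) :
  (forall k, \sum_(i < (2 ^ k.+1)%N) f i = 0) ->
  dyadic_bounded f.
Proof.
move=> f0; exists `|f 0%N|%N => [[|k]]; last by rewrite f0.
by rewrite big_ord_recl big_ord0 addr0 /=; lia.
Qed.

(** Shift 2q reduces to [corr q], and 2q + 1 to [alt_corr] at q and q + 1, so both claims are proved
    together. Since q + 1 < 2q + 1 needs q > 0, shift 1 is a base case. *)
Lemma corr_bounded_alt_corr_bounded p :
  ((0 < p)%N -> dyadic_bounded (corr p)) /\ dyadic_bounded (alt_corr p).
Proof.
elim/ltn_ind: p => p IH.
have [->|->|p_gt1] : [\/ p = 0%N, p = 1%N | (1 < p)%N].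
- by case: p {IH} => [|[|p]]; [constructor 1|constructor 2|constructor 3].
- split=> //; exact/dyadic_bounded_of_sums0/sum_alt_corr0.
- have alt1 := dyadic_bounded_of_sums0 sum_alt_corr1.
  have alt0 := dyadic_bounded_of_sums0 sum_alt_corr0.
  split=> // _; apply: dyadic_bounded_halve.
  apply: dyadic_bounded_ext (dyadic_boundedD alt0 alt1) => n.
  by rewrite (corr_doubleS_pair 0) mul1r.
have := odd_double_half p; case: (odd p) => /=; set q := p./2 => def_p.
- have [q_gt0 ltqp ltq1p] : [/\ (0 < q), (q < p) & (q.+1 < p)]%N by split; lia.
  have [[_ bq] [_ bq1]] := (IH q ltqp, IH q.+1 ltq1p).
  rewrite -def_p add1n; split=> [_|]; apply: dyadic_bounded_halve.
    apply: dyadic_bounded_ext (fun n => esym (corr_doubleS_pair q n)) _.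
    exact: dyadic_boundedD (dyadic_boundedM _ bq) bq1.
  apply: dyadic_bounded_ext (fun n => esym (alt_corr_doubleS_pair q n)) _.
  exact: dyadic_boundedD (dyadic_boundedM _ bq) (dyadic_boundedM _ bq1).
have [q_gt0 ltqp] : [/\ (0 < q) & (q < p)]%N by split; lia.
have [/(_ q_gt0) bq _] := IH q ltqp.
rewrite -def_p add0n; split=> [_|]; apply: dyadic_bounded_halve.
  apply: dyadic_bounded_ext (fun n => esym (corr_double_pair q n)) _.
  exact: dyadic_boundedM.
apply: dyadic_bounded_ext (fun n => esym (alt_corr_double_pair q n)) _.
exact: dyadic_boundedM.
Qed.

Lemma corr_bounded p : (0 < p)%N -> dyadic_bounded (corr p).
Proof. by case: (corr_bounded_alt_corr_bounded p). Qed.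

Lemma corr_shift_bounded p q : (p < q)%N ->
  dyadic_bounded (fun n => rs_sign (n + p) * rs_sign (n + q)).
Proof.
move=> ltpq; have /corr_bounded bpq : (0 < q - p)%N by rewrite subn_gt0.
apply: dyadic_bounded_ext (dyadic_bounded_shift p (@norm_corr _) bpq) => n.
by rewrite /corr -addnA subnKC // ltnW.
Qed.

(** * From a recurrence to a period, and the contradiction *)

Lemma eventually_periodic_of_recurrence (T : finType) (f : nat -> T) m N :
    (forall i j, (N <= i)%N -> (N <= j)%N ->
       (forall t, (t < m)%N -> f (i + t)%N = f (j + t)%N) ->
       f (i + m)%N = f (j + m)%N) ->
  exists P M, (0 < P)%N /\ forall i, (M <= i)%N -> f (i + P)%N = f i.
Proof.
move=> rec; pose window i := [ffun t : 'I_m => f (i + t)%N].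
(* Pigeonhole: one more window than there are values, so two windows past N agree; the recurrence
   then propagates the agreement. *)
have /injectivePn [a [b neq_ab eq_ab]] :
    ~~ injectiveb (fun a : 'I_#|{ffun 'I_m -> T}|.+1 => window (N + a)%N).
  by apply/negP=> /injectiveP/leq_card; rewrite card_ord ltnn.
wlog lt_ab : a b neq_ab eq_ab / (a < b)%N.
  move=> wlog_ab; have := neq_ab; rewrite -val_eqE neq_ltn.
  case/orP; first exact: wlog_ab.
  by apply: wlog_ab; rewrite 1?eq_sym.
exists (b - a)%N, (N + a)%N; split=> [|i leNi]; first by rewrite subn_gt0.
have eq_from d : f (N + b + d)%N = f (N + a + d)%N.
  elim/ltn_ind: d => d IH; have [ltdm|lemd] := ltnP d m.
    by have /ffunP/(_ (Ordinal ltdm)) := eq_ab; rewrite !ffunE.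
  rewrite -(subnK lemd) !addnA; apply: rec; [lia|lia|] => t lttm.
  by rewrite -(addnA (N + b)%N) -(addnA (N + a)%N) IH //; lia.
by rewrite -(subnKC leNi) -(eq_from (i - (N + a))%N); congr f; lia.
Qed.

Lemma rudin_shapiro_not_3pseudoperiodic p q r :
  ~ has_pseudoperiod rudin_shapiro [:: p; q; r].
Proof.
case=> _ /= /and4P[p_gt0 ltpq ltqr _] per.
have pos : (0 < q)%N /\ (0 < r)%N by lia.
have ltpr := ltn_trans ltpq ltqr.
pose defect n : int :=
  1 - rs_sign n * rs_sign (n + p) * rs_sign (n + q) * rs_sign (n + r).
have defect_ge0 n : 0 <= defect n.
  rewrite /defect /rs_sign.
  by case: (rs_bit n); case: (rs_bit _); case: (rs_bit _); case: (rs_bit _).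
have defect_bounded : dyadic_bounded defect.
  have B1 := dyadic_boundedD (corr_bounded p_gt0)
    (dyadic_boundedD (corr_bounded pos.1) (corr_bounded pos.2)).
  have B2 := dyadic_boundedD (corr_shift_bounded ltpq)
    (dyadic_boundedD (corr_shift_bounded ltpr) (corr_shift_bounded ltqr)).
  (* Expanding (1 - x)(1 - y)(1 - z) = 0 gives 1 - xyz = (x + y + z) - (xy + xz + yz), where squares
     of signs cancel. *)
  apply: dyadic_bounded_ext (dyadic_boundedD B1 (dyadic_boundedM (-1) B2)) => n.
  have := per n; rewrite /= !inE !rudin_shapiroE !(inj_eq (can_inj oddb)).
  rewrite /defect /corr /rs_sign.
  by case: (rs_bit n); case: (rs_bit _); case: (rs_bit _); case: (rs_bit _).
apply: (dyadic_bounded_eventually0 defect_ge0 defect_bounded) => -[N defect0].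
have recur n : (N <= n)%N ->
    rs_bit (n + r) = rs_bit n (+) rs_bit (n + p) (+) rs_bit (n + q).
  move=> /defect0; rewrite /defect /rs_sign.
  by case: (rs_bit n); case: (rs_bit _); case: (rs_bit _); case: (rs_bit _).
(* A window of length r contains the offsets 0, p and q that determine the letter at offset r. *)
have [|P [M [P_gt0 perP]]] := @eventually_periodic_of_recurrence _ rs_bit r N.
  move=> i j leNi leNj eq_ij; have := eq_ij 0%N pos.2.
  by rewrite !addn0 !recur // => ->; rewrite !eq_ij.
apply: (dyadic_bounded_not1 (N := M) (@norm_corr P) (corr_bounded P_gt0)).
by move=> n /perP; rewrite /corr /rs_sign => ->; rewrite -expr2 sqrr_sign.
Qed.

Local Close Scope ring_scope.

Theorem theorem27 :
  pseudoperiodic 4 rudin_shapiro /\ ~ pseudoperiodic 3 rudin_shapiro.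
Proof.
split; first by exists [tuple 2; 3; 4; 5]; exact: rudin_shapiro_pseudoperiod_2345.
by case=> -[[|p [|q [|r []]]] // _] /rudin_shapiro_not_3pseudoperiodic.
Qed.
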